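(* Let $\mathbb{K}$ be a field of characteristic $0$, let $n,k\geq 1$ be integers, let $a\in\mathbb{K}$, and let $f_1,\ldots,f_n\in\mathbb{K}[u]$ and $Q_1,\ldots,Q_n\in\mathbb{K}[y_1,\ldots,y_{n(k+1)},t,u]$ be polynomials. For $F\in\mathbb{K}[u][[t]]$ set $\Delta_a F(t,u):=\frac{F(t,u)-F(t,a)}{u-a}$ and $\nabla_a^kF:=(F,\Delta_aF,\ldots,\Delta_a^kF)$, where $\Delta_a^j$ denotes the $j$-th iterate of $\Delta_a$. Then the system of equations $$F_i = f_i(u) + t\cdot Q_i(\nabla_a^kF_1,\ldots,\nabla_a^kF_n,t,u),\qquad i=1,\ldots,n,$$ admits a unique solution $(F_1,\ldots,F_n)\in\mathbb{K}[u][[t]]^n$, and each component $F_i$ is algebraic over $\mathbb{K}(t,u)$. *)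

(* Defs.v *)
(* boolp is Required but not Imported: its notations clash with mpoly's, and it
   only provides the classical eqType/choiceType structures on fps. *)
From HB Require Import structures.
From mathcomp Require Import all_boot all_order all_algebra.
From mathcomp Require Import generic_quotient.
From mathcomp Require Import mpoly.
From mathcomp Require boolp.

Set Implicit Arguments.
Unset Strict Implicit.
Unset Printing Implicit Defensive.

Import GRing.Theory.
Local Open Scope ring_scope.

Record fps (R : Type) := Fps { fps_coef :> nat -> R }.

Notation "{ 'fps' R }" := (fps R) (at level 0, format "{ 'fps'  R }").

HB.instance Definition _ (R : Type) := boolp.gen_eqMixin (fps R).
HB.instance Definition _ (R : Type) := boolp.gen_choiceMixin (fps R).

Lemma fpsP (R : Type) (f g : {fps R}) : f =1 g <-> f = g.
Proof.
split=> [|-> //]; case: f g => [f] [g] /= fg.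
by congr Fps; apply: boolp.funext.
Qed.

Section FpsZmodule.
Variable R : zmodType.
Implicit Types f g h : {fps R}.

Definition fps_zero : {fps R} := Fps (fun=> 0).
Definition fps_opp f : {fps R} := Fps (fun m => - f m).
Definition fps_add f g : {fps R} := Fps (fun m => f m + g m).

Fact fps_addA : associative fps_add.
Proof. by move=> f g h; apply/fpsP => m /=; rewrite addrA. Qed.
Fact fps_addC : commutative fps_add.
Proof. by move=> f g; apply/fpsP => m /=; rewrite addrC. Qed.
Fact fps_add0 : left_id fps_zero fps_add.
Proof. by move=> f; apply/fpsP => m /=; rewrite add0r. Qed.
Fact fps_addN : left_inverse fps_zero fps_opp fps_add.
Proof. by move=> f; apply/fpsP => m /=; rewrite addNr. Qed.

HB.instance Definition _ :=
  GRing.isZmodule.Build {fps R} fps_addA fps_addC fps_add0 fps_addN.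

Lemma coef_fps0 m : (0 : {fps R}) m = 0. Proof. by []. Qed.
Lemma coef_fpsD f g m : (f + g) m = f m + g m. Proof. by []. Qed.
Lemma coef_fpsN f m : (- f) m = - f m. Proof. by []. Qed.
Lemma coef_fpsB f g m : (f - g) m = f m - g m. Proof. by []. Qed.

End FpsZmodule.

Section FpsRing.
Variable R : comNzRingType.
Implicit Types f g h : {fps R}.

Definition fps_of_poly (p : {poly R}) : {fps R} := Fps (fun m => p`_m).

Definition fps_mul f g : {fps R} :=
  Fps (fun m => \sum_(i < m.+1) f i * g (m - i)%N).

Definition fps_trunc m f : {poly R} := \poly_(i < m.+1) f i.

Lemma coef_fps_trunc m f i : (i <= m)%N -> (fps_trunc m f)`_i = f i.
Proof. by move=> le_im; rewrite coef_poly ltnS le_im. Qed.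

Lemma fps_mul_trunc m f g i : (i <= m)%N ->
  fps_mul f g i = (fps_trunc m f * fps_trunc m g)`_i.
Proof.
move=> le_im; rewrite coefM /=; apply: eq_bigr => j _.
have le_ji : (j <= i)%N by rewrite -ltnS.
by rewrite !coef_fps_trunc // ?(leq_trans (leq_subr _ _)) ?(leq_trans le_ji).
Qed.

Fact fps_mulC : commutative fps_mul.
Proof.
by move=> f g; apply/fpsP => m; rewrite !(@fps_mul_trunc m) // mulrC.
Qed.

Fact fps_mulA : associative fps_mul.
Proof.
move=> f g h; apply/fpsP => m.
transitivity (fps_trunc m f * (fps_trunc m g * fps_trunc m h))`_m.
  rewrite coefM /=; apply: eq_bigr => i _.
  have le_im : (i <= m)%N by rewrite -ltnS.
  by rewrite coef_fps_trunc // -fps_mul_trunc ?leq_subr.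
rewrite mulrA coefM /=; apply: eq_bigr => i _.
have le_im : (i <= m)%N by rewrite -ltnS.
by rewrite coef_fps_trunc ?leq_subr // -fps_mul_trunc.
Qed.

Fact fps_mul1 : left_id (fps_of_poly 1) fps_mul.
Proof.
move=> f; apply/fpsP => m /=.
rewrite big_ord_recl /= coef1 mul1r subn0 big1 ?addr0 // => i _.
by rewrite coef1 mul0r.
Qed.

Fact fps_mulDl : left_distributive fps_mul +%R.
Proof.
move=> f g h; apply/fpsP => m /=; rewrite -big_split /=.
by apply: eq_bigr => i _; rewrite mulrDl.
Qed.

Fact fps_one_neq0 : fps_of_poly 1 != 0.
Proof.
by apply/eqP => /fpsP /(_ 0%N) /= /eqP; rewrite coef1 oner_eq0.
Qed.

HB.instance Definition _ := GRing.Zmodule_isComNzRing.Build {fps R}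
  fps_mulA fps_mulC fps_mul1 fps_mulDl fps_one_neq0.

Lemma coef_fpsM f g m : (f * g) m = \sum_(i < m.+1) f i * g (m - i)%N.
Proof. by []. Qed.

Fact fps_of_poly_is_zmod_morphism : zmod_morphism fps_of_poly.
Proof. by move=> p q; apply/fpsP => m /=; rewrite coefB. Qed.

Fact fps_of_poly_is_monoid_morphism : monoid_morphism fps_of_poly.
Proof.
by split=> // p q; apply/fpsP => m; rewrite coef_fpsM /= coefM.
Qed.

HB.instance Definition _ :=
  GRing.isZmodMorphism.Build {poly R} {fps R} fps_of_poly
    fps_of_poly_is_zmod_morphism.
HB.instance Definition _ :=
  GRing.isMonoidMorphism.Build {poly R} {fps R} fps_of_poly
    fps_of_poly_is_monoid_morphism.

Lemma fps_of_poly_inj : injective fps_of_poly.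
Proof. by move=> p q /fpsP pq; apply/polyP => i; apply: pq. Qed.

Definition fps_unit : {pred {fps R}} :=
  fun f => boolp.asbool (exists g, g * f = 1).

Definition fps_inv f : {fps R} :=
  if boolp.pselect (exists g, g * f = 1) is left ex
  then projT1 (boolp.cid ex) else f.

Fact fps_mulVx : {in fps_unit, left_inverse 1 fps_inv *%R}.
Proof.
move=> f /boolp.asboolP uf; rewrite /fps_inv.
by case: boolp.pselect => // ex; case: boolp.cid.
Qed.

Fact fps_unitPl f g : g * f = 1 -> fps_unit f.
Proof. by move=> gf; apply/boolp.asboolP; exists g. Qed.

Fact fps_inv_out : {in [predC fps_unit], fps_inv =1 id}.
Proof.
move=> f /boolp.asboolP uf; rewrite /fps_inv.
by case: boolp.pselect.
Qed.

HB.instance Definition _ := GRing.ComNzRing_hasMulInverse.Build {fps R}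
  fps_mulVx fps_unitPl fps_inv_out.

End FpsRing.

Section FpsIdomain.
Variable R : idomainType.
Implicit Types f g : {fps R}.

Lemma fps_order f : f != 0 ->
  exists2 i, f i != 0 & forall j, (j < i)%N -> f j = 0.
Proof.
move=> nz_f; have exf : exists i, f i != 0.
  apply: boolp.contrapT => nex; case/eqP: nz_f; apply/fpsP => i.
  by apply/eqP; apply/negPn/negP => nz; apply: nex; exists i.
exists (ex_minn exf); case: ex_minnP => i fi min_i // j lt_ji.
by apply/eqP; apply: contraTT lt_ji => /min_i; rewrite -leqNgt.
Qed.

Fact fps_mul_eq0 f g : f * g = 0 -> (f == 0) || (g == 0).
Proof.
move=> fg0; apply/negPn; rewrite negb_or; apply/negP.
move=> /andP[/fps_order[i fi lti] /fps_order[j gj ltj]].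
have /eqP := congr1 (fun h : {fps R} => h (i + j)%N) fg0.
rewrite coef_fpsM coef_fps0.
have lt_i : (i < (i + j).+1)%N by rewrite ltnS leq_addr.
rewrite (bigD1 (Ordinal lt_i)) //= addKn big1 ?addr0.
  by rewrite mulf_eq0 (negPf fi) (negPf gj).
move=> l; rewrite -val_eqE /= => ne_li.
have [lt_li|le_il] := ltnP l i; first by rewrite lti ?mul0r.
have lt_il : (i < l)%N by rewrite ltn_neqAle eq_sym ne_li.
rewrite [g _]ltj ?mulr0 // ltn_subLR ?ltn_add2r //.
by rewrite -ltnS.
Qed.

HB.instance Definition _ :=
  GRing.ComUnitRing_isIntegral.Build {fps R} fps_mul_eq0.

End FpsIdomain.

Section FracMap.
Local Open Scope quotient_scope.
Variables (R S : idomainType) (phi : R -> S).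

(* meaningful only when phi is an injective ring morphism *)
Definition frac_map (x : {fraction R}) : {fraction S} :=
  FracField.tofrac (phi \n_(repr x)) / FracField.tofrac (phi \d_(repr x)).

End FracMap.

Section FracMapTheory.
Local Open Scope quotient_scope.
Variables (R S : idomainType) (phi : {rmorphism R -> S}).
Hypothesis phi_inj : injective phi.

Local Notation tofrac := (@FracField.tofrac _).

Lemma frac_eqP (x : {fraction R}) (p q : R) : q != 0 ->
  x = tofrac p / tofrac q <-> p * \d_(repr x) = q * \n_(repr x).
Proof.
move=> nz_q.
have nz_d : \d_(repr x) != 0 by apply: denom_ratioP.
have ratioE (r : {ratio R}) :
    \pi_(FracField.type R) r * tofrac \d_r = tofrac \n_r.
  case: r => -[c d] /= nz_e; rewrite /FracField.tofrac; unlock.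
  rewrite -[LHS]FracField.pi_mul; apply/eqmodP.
  rewrite /= FracField.equivfE /FracField.mulf /=.
  by rewrite !numden_Ratio ?oner_eq0 ?mulr1 // mulrC.
have eq_x : x * tofrac \d_(repr x) = tofrac \n_(repr x).
  by rewrite -ratioE reprK.
have nzF y : y != 0 -> tofrac y != 0 :> {fraction R} by rewrite tofrac_eq0.
split=> [eqx | /(congr1 tofrac)].
  apply/eqP; rewrite -tofrac_eq !tofracM -eq_x {2}eqx.
  by rewrite mulrA mulrCA mulfV ?mulr1 ?nzF.
rewrite !tofracM -eq_x mulrA => /(mulIf (nzF _ nz_d)) ->.
by rewrite mulrAC mulfV ?mul1r ?nzF.
Qed.

Lemma frac_mapE (p q : R) : q != 0 ->
  frac_map phi (tofrac p / tofrac q) = tofrac (phi p) / tofrac (phi q).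
Proof.
move=> nz_q; rewrite /frac_map; set x := tofrac p / _.
have nz_d : \d_(repr x) != 0 by apply: denom_ratioP.
have /(congr1 phi) : p * \d_(repr x) = q * \n_(repr x) by apply/frac_eqP.
have nzF y : y != 0 -> tofrac (phi y) != 0 :> {fraction S}.
  by rewrite tofrac_eq0 -(inj_eq phi_inj) rmorph0.
rewrite !rmorphM /= => /(congr1 tofrac); rewrite !tofracM => eq_pq.
by apply/eqP; rewrite eqr_div ?nzF // -mulrC -eq_pq mulrC.
Qed.

Lemma frac_map_tofrac (p : R) : frac_map phi (tofrac p) = tofrac (phi p).
Proof.
have := @frac_mapE p 1 (oner_neq0 _).
by rewrite rmorph1 !tofrac1 !divr1.
Qed.

Lemma fracW (x : {fraction R}) : exists p q, q != 0 /\ x = tofrac p / tofrac q.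
Proof.
exists \n_(repr x), \d_(repr x); split; first exact: denom_ratioP.
by apply/frac_eqP; rewrite ?denom_ratioP // mulrC.
Qed.

Lemma frac_map_is_zmod_morphism : zmod_morphism (frac_map phi).
Proof.
move=> x y; have [p [q [nz_q ->]]] := fracW x; have [r [s [nz_s ->]]] := fracW y.
have nzF z : z != 0 -> tofrac z != 0 :> {fraction R} by rewrite tofrac_eq0.
have nzP z : z != 0 -> tofrac (phi z) != 0 :> {fraction S}.
  by rewrite tofrac_eq0 -(inj_eq phi_inj) rmorph0.
rewrite -mulNr addf_div ?nzF // -tofracN -!tofracM -tofracD.
rewrite !frac_mapE ?mulf_neq0 // rmorphD !rmorphM rmorphN /=.
by rewrite tofracD !tofracM tofracN -addf_div ?nzP // mulNr.
Qed.

Lemma frac_map_is_monoid_morphism : monoid_morphism (frac_map phi).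
Proof.
split=> [|x y]; first by rewrite -tofrac1 frac_map_tofrac rmorph1.
have [p [q [nz_q ->]]] := fracW x; have [r [s [nz_s ->]]] := fracW y.
rewrite mulf_div -!tofracM !frac_mapE ?mulf_neq0 //.
by rewrite !rmorphM /= mulf_div.
Qed.

End FracMapTheory.

Section CatalyticSystem.
Variable K : fieldType.
Implicit Types (F : {fps {poly K}}) (a : K).

(* K[u][t] is {poly {poly K}}: u is the inner variable, t the outer one. *)
Definition fps_t : {fps {poly K}} := fps_of_poly 'X.
Definition fps_u : {fps {poly K}} := fps_of_poly 'X%:P.
Definition fps_const (c : K) : {fps {poly K}} := fps_of_poly c%:P%:P.

(* F(t,a) *)
Definition eval_u a F : {fps {poly K}} := Fps (fun m => (F m).[a]%:P).

(* the division is exact, see Delta_spec and Delta_unique *)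
Definition Delta a F : {fps {poly K}} :=
  Fps (fun m => (F m - (F m).[a]%:P) %/ ('X - a%:P)).

Lemma coef_fpsCM (p : {poly K}) F m : (fps_of_poly p%:P * F) m = p * F m.
Proof.
rewrite coef_fpsM big_ord_recl /= coefC /= subn0 big1 ?addr0 // => i _.
by rewrite coefC /= mul0r.
Qed.

Lemma fps_u_const a : fps_u - fps_const a = fps_of_poly ('X - a%:P)%:P.
Proof. by rewrite /fps_u /fps_const polyCB rmorphB. Qed.

Lemma Delta_spec a F : (fps_u - fps_const a) * Delta a F = F - eval_u a F.
Proof.
rewrite fps_u_const; apply/fpsP => m; rewrite coef_fpsCM coef_fpsB /= mulrC.
by rewrite divpK // dvdp_XsubCl rootE !hornerE subrr.
Qed.

Lemma Delta_unique a F G :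
  (fps_u - fps_const a) * G = F - eval_u a F -> G = Delta a F.
Proof.
rewrite -Delta_spec; apply: mulfI; rewrite fps_u_const.
by rewrite raddf_eq0 ?polyC_eq0 ?polyXsubC_eq0 //; apply: fps_of_poly_inj.
Qed.

Definition nabla a k F : seq {fps {poly K}} := traject (Delta a) F k.+1.

(* the argument list (nabla F_1, ..., nabla F_n, t, u) *)
Definition system_args a k n (F : 'I_n -> {fps {poly K}}) :
    seq {fps {poly K}} :=
  flatten [seq nabla a k (F i) | i <- enum 'I_n] ++ [:: fps_t; fps_u].

Lemma size_system_args a k n (F : 'I_n -> {fps {poly K}}) :
  size (system_args a k F) = (n * k.+1 + 2)%N.
Proof.
rewrite size_cat size_flatten /shape -map_comp; congr (_ + _)%N.
rewrite (eq_map (_ : _ =1 fun=> k.+1)) => [|i /=]; last by rewrite size_traject.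
by rewrite sumnE big_map big_const_seq count_predT size_enum_ord iter_addn_0 mulnC.
Qed.

Lemma nth_system_args a k n (F : 'I_n -> {fps {poly K}}) (i : 'I_n) j :
  (j <= k)%N -> (system_args a k F)`_(i * k.+1 + j) = iter j (Delta a) (F i).
Proof.
move=> le_jk.
have szs (s : seq 'I_n) :
    size (flatten [seq nabla a k (F l) | l <- s]) = (size s * k.+1)%N.
  elim: s => //= l s IHs.
  by rewrite size_cat IHs size_traject -addSn mulSn.
rewrite nth_cat szs size_enum_ord.
have lt_ij : (i * k.+1 + j < n * k.+1)%N.
  by rewrite (@leq_trans (i.+1 * k.+1)) ?leq_mul2r ?ltn_ord ?orbT // mulSn
             addnC ltn_add2r ltnS.
rewrite lt_ij -{1}[enum 'I_n](cat_take_drop i) map_cat flatten_cat nth_cat szs.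
rewrite size_take size_enum_ord ltn_ord ltnNge leq_addr /= addKn.
rewrite (drop_nth i) ?size_enum_ord // nth_ord_enum map_cons.
rewrite -[flatten _]/(nabla a k (F i) ++ _) nth_cat size_traject ltnS le_jk.
by rewrite (set_nth_default (F i)) ?size_traject ?nth_traject.
Qed.

Definition eval_system a k n (Q : {mpoly K[n * k.+1 + 2]})
    (F : 'I_n -> {fps {poly K}}) : {fps {poly K}} :=
  mmap fps_const (fun v => (system_args a k F)`_v) Q.

Definition is_solution a k n (f : 'I_n -> {poly K})
    (Q : 'I_n -> {mpoly K[n * k.+1 + 2]}) (F : 'I_n -> {fps {poly K}}) :=
  forall i, F i = fps_of_poly (f i)%:P + fps_t * eval_system a (Q i) F.

(* K(t,u) = Frac K[u][t] inside Frac K[u][[t]] *)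
Definition ratfun_embed :
    {fraction {poly {poly K}}} -> {fraction {fps {poly K}}} :=
  frac_map (@fps_of_poly {poly K}).

HB.instance Definition _ :=
  GRing.isZmodMorphism.Build _ _ ratfun_embed
    (frac_map_is_zmod_morphism (@fps_of_poly_inj {poly K})).
HB.instance Definition _ :=
  GRing.isMonoidMorphism.Build _ _ ratfun_embed
    (frac_map_is_monoid_morphism (@fps_of_poly_inj {poly K})).

Definition algebraic_tu F : Prop :=
  algebraicOver ratfun_embed (FracField.tofrac F).

End CatalyticSystem.

(* Main.v *)
(* Put [v = u - a].  Writing [F_i = \sum_(l < k) v^l z_(i,l) + v^k H_i] with
   [z_(i,l)] in [K[[t]]] turns the system into polynomial equations
   [e_i(H, z) = 0] over [K[t,u]], and [d = det (de/dH)] is [v^(nk)] modulo [t].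
   If some [z] were transcendental over [K(t)], there would be a derivation [D]
   of [Frac K[[t]]] killing [K(t)] but not [z].  It cannot be applied to the
   infinite series [H], so [H] is first reduced to a polynomial [h] in [u]
   modulo [W^2], where [W] in [K[[t]][u]] is a monic multiple of [d]
   (Weierstrass).  As [D] maps multiples of [W^2] to multiples of [W],
   differentiating [e(h, z) = 0 mod W^2] gives [(de/dH) Dh + (de/dz) Dz = 0]
   modulo [d], and Cramer's rule then produces an exact solution [(G, Dz)], with
   [G] in [K[u][[t]]], of the linearized system.  That system is a linear
   contraction in the [t]-adic topology, so [Dz = 0], a contradiction.  Finally
   every derivation killing [K(t,u)] kills the [z_(i,l)], hence the [H_i],
   because [d <> 0]. *)

Require Import Defs.
From HB Require Import structures.
From mathcomp Require Import all_boot all_order all_algebra.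
From mathcomp Require Import polyXY mpoly zify ring.
From mathcomp Require boolp classical_sets.

Set Implicit Arguments.
Unset Strict Implicit.
Unset Printing Implicit Defensive.

Import GRing.Theory.
Local Open Scope ring_scope.

(** * Derivations *)

Definition leibniz (R S : comNzRingType) (phi D : R -> S) :=
  forall x y, D (x * y) = phi x * D y + D x * phi y.

Lemma deriv_eq0_pchar0 (M : fieldType) (p : {poly M}) :
  [pchar M] =i pred0 -> p^`() = 0 -> p = (p`_0)%:P.
Proof.
move=> /pcharf0P charM dp0; apply/polyP => -[|i]; rewrite coefC //=.
have /eqP := congr1 (fun q : {poly M} => q`_i) dp0.
by rewrite coef_deriv coef0 -mulr_natr mulf_eq0 charM orbF => /eqP.
Qed.

Section DualSubring.
Variable M : fieldType.
Hypothesis pcharM : [pchar M] =i pred0.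

(* A partial derivation of M is encoded by its graph, which is a subring of
   the dual numbers M[eps] meeting M eps trivially. *)
Record dual_subring (G : M -> M -> Prop) : Prop := DualSubring {
  dual1 : G 1 0;
  dualB : forall x x' y y', G x x' -> G y y' -> G (x - y) (x' - y');
  dualM : forall x x' y y', G x x' -> G y y' -> G (x * y) (x * y' + x' * y);
  dual_functional : forall x', G 0 x' -> x' = 0 }.

Definition dual_poly (G : M -> M -> Prop) (P P' : {poly M}) :=
  forall i, G P`_i P'`_i.

Definition dual_adjoin (G : M -> M -> Prop) (x x' y y' : M) :=
  exists P P', [/\ dual_poly G P P', y = P.[x] &
                   y' = P'.[x] + P^`().[x] * x'].

Section Theory.
Variable G : M -> M -> Prop.
Hypothesis dG : dual_subring G.

Lemma dual0 : G 0 0.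
Proof. by have := dualB dG (dual1 dG) (dual1 dG); rewrite !subrr. Qed.

Lemma dualD x x' y y' : G x x' -> G y y' -> G (x + y) (x' + y').
Proof.
move=> Gx Gy; have := dualB dG Gx (dualB dG dual0 Gy).
by rewrite !sub0r !opprK.
Qed.

Lemma dualMn x x' n : G x x' -> G (x *+ n) (x' *+ n).
Proof.
by move=> Gx; elim: n => [|n IHn]; [exact: dual0 | rewrite !mulrSr; apply: dualD].
Qed.

Lemma dual_sum n (f f' : nat -> M) : (forall i, G (f i) (f' i)) ->
  G (\sum_(i < n) f i) (\sum_(i < n) f' i).
Proof.
move=> Gf; elim: n => [|n IHn]; first by rewrite !big_ord0; apply: dual0.
by rewrite !big_ord_recr; apply: dualD.
Qed.

Lemma dual_polyB P P' Q Q' : dual_poly G P P' -> dual_poly G Q Q' ->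
  dual_poly G (P - Q) (P' - Q').
Proof. by move=> GP GQ i; rewrite !coefB; apply: dualB. Qed.

Lemma dual_polyM P P' Q Q' : dual_poly G P P' -> dual_poly G Q Q' ->
  dual_poly G (P * Q) (P * Q' + P' * Q).
Proof.
move=> GP GQ i; rewrite coefD !coefM -big_split /=.
apply: (@dual_sum _ (fun j => P`_j * Q`_(i - j))
  (fun j => P`_j * Q'`_(i - j) + P'`_j * Q`_(i - j))) => j; exact: dualM.
Qed.

Lemma dual_polyC c c' : G c c' -> dual_poly G c%:P c'%:P.
Proof. by move=> Gc i; rewrite !coefC; case: ifP => // _; apply: dual0. Qed.

Lemma dual_polyXn n : dual_poly G 'X^n 0.
Proof.
move=> i; rewrite coef0 coefXn.
by case: eqP => _; [apply: dual1 | apply: dual0].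
Qed.

Lemma dual_poly_deriv P P' : dual_poly G P P' -> dual_poly G P^`() P'^`().
Proof. by move=> GP i; rewrite !coef_deriv; apply: dualMn. Qed.

Lemma dual_poly_eq0 P' : dual_poly G 0 P' -> P' = 0.
Proof.
move=> GP; apply/polyP => i; rewrite coef0; apply: dual_functional dG _ _.
by have := GP i; rewrite coef0.
Qed.

Lemma sub_dual_adjoin x x' y y' : G y y' -> dual_adjoin G x x' y y'.
Proof.
move=> Gy; exists y%:P, y'%:P; split; rewrite ?hornerC //; first exact: dual_polyC.
by rewrite derivC horner0 mul0r addr0.
Qed.

Lemma dual_adjoin_gen x x' : dual_adjoin G x x' x x'.
Proof.
exists 'X, 0; rewrite !hornerE derivX hornerC; split=> //; last by rewrite mul1r.
exact: (dual_polyXn 1).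
Qed.

Lemma dual_subring_adjoin x x' :
  (forall P P', dual_poly G P P' -> P.[x] = 0 ->
    P'.[x] + P^`().[x] * x' = 0) ->
  dual_subring (dual_adjoin G x x').
Proof.
move=> funG; split.
- by apply: sub_dual_adjoin; apply: dual1.
- move=> _ _ _ _ [P [P' [GP -> ->]]] [Q [Q' [GQ -> ->]]].
  exists (P - Q), (P' - Q'); split; rewrite ?derivB ?hornerE //.
    exact: dual_polyB.
  by ring.
- move=> _ _ _ _ [P [P' [GP -> ->]]] [Q [Q' [GQ -> ->]]].
  exists (P * Q), (P * Q' + P' * Q); split; rewrite ?derivM ?hornerE //.
    exact: dual_polyM.
  by ring.
by move=> _ [P [P' [GP P0 ->]]]; apply: funG.
Qed.

(* The value of the derivation at an algebraic x is forced by the equation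
   P(x) = 0 of minimal degree, and arbitrary at a transcendental x. *)
Lemma dual_adjoin_exists x : exists x', dual_subring (dual_adjoin G x x').
Proof.
pose rel P P' := [/\ dual_poly G P P', P != 0 & P.[x] = 0].
have [[P0 [P0' relP0]]|no_rel] := boolp.EM (exists P P', rel P P'); last first.
  exists 0; apply: dual_subring_adjoin => P P' GP Px0.
  have [P0|nzP] := eqVneq P 0; last by case: no_rel; exists P, P'.
  by move: GP; rewrite mulr0 addr0 P0 => /dual_poly_eq0->; rewrite horner0.
have [P [P' [relP minP]]] : exists P P', rel P P' /\
    forall Q Q', dual_poly G Q Q' -> Q.[x] = 0 -> (size Q < size P)%N -> Q = 0.
  move: {2}(size P0) (leqnn (size P0)) => n.
  elim: n P0 P0' relP0 => [|n IHn] P0 P0' relP0 le_n.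
    by case: relP0; rewrite -size_poly_gt0 ltnNge le_n.
  have [[Q [Q' [relQ ltQ]]]|nex] := boolp.EM
      (exists Q Q', rel Q Q' /\ (size Q < size P0)%N).
    by apply: IHn relQ _; rewrite -ltnS (leq_trans ltQ).
  exists P0, P0'; split=> // Q Q' GQ Qx ltQ; have [//|nzQ] := eqVneq Q 0.
  by case: nex; exists Q, Q'.
have [GP nzP Px0] := relP.
have nz_dPx : P^`().[x] != 0.
  apply: contra_neq (nzP) => dPx0.
  have /(deriv_eq0_pchar0 pcharM) defP : P^`() = 0.
    exact: minP (dual_poly_deriv GP) dPx0 (lt_size_deriv nzP).
  by move: Px0; rewrite defP hornerC => ->.
have [x' evP] : exists x', P'.[x] + P^`().[x] * x' = 0.
  by exists (- P'.[x] / P^`().[x]); rewrite mulrC divfK ?subrr.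
exists x'; apply: dual_subring_adjoin => Q Q'.
move: {2}(size Q) (leqnn (size Q)) => n.
elim: n Q Q' => [|n IHn] Q Q' le_n GQ Qx0.
  have Q0 : Q = 0 by apply/eqP; rewrite -size_poly_leq0.
  by move: GQ; rewrite Q0 => /dual_poly_eq0->; rewrite deriv0 !horner0 mul0r addr0.
have [ltQP|lePQ] := ltnP (size Q) (size P).
  have Q0 := minP _ _ GQ Qx0 ltQP.
  by move: GQ; rewrite Q0 => /dual_poly_eq0->; rewrite deriv0 !horner0 mul0r addr0.
pose c := lead_coef P; pose c' := P'`_(size P).-1.
pose b := lead_coef Q; pose b' := Q'`_(size Q).-1.
pose m := (size Q - size P)%N.
have nz_c : c != 0 by rewrite lead_coef_eq0.
pose T := c%:P * Q - b%:P * 'X^m * P.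
pose T' := (c%:P * Q' + c'%:P * Q)
  - (b%:P * 'X^m * P' + (b%:P * 0 + b'%:P * 'X^m) * P).
have GT : dual_poly G T T'.
  apply: dual_polyB; first by apply: dual_polyM => //; apply: dual_polyC (GP _).
  apply: dual_polyM => //; apply: dual_polyM; last exact: dual_polyXn.
  exact: dual_polyC (GQ _).
have Tx0 : T.[x] = 0 by rewrite /T !hornerE Px0 Qx0; ring.
have ltTQ : (size T <= n)%N.
  have szQ : (0 < size Q)%N by rewrite (leq_trans _ lePQ) // size_poly_gt0.
  have szP : (0 < size P)%N by rewrite size_poly_gt0.
  rewrite -ltnS (leq_trans _ le_n) // -(prednK szQ) ltnS.
  apply/leq_sizeP => j le_j; rewrite coefB -mulrA !coefCM coefXnM.
  have szE : (size Q).-1 = ((size P).-1 + m)%N by rewrite /m; lia.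
  have le_mj : (m <= j)%N by lia.
  rewrite ltnNge le_mj /=.
  have [->|ne_j] := eqVneq j (size Q).-1.
    by rewrite {2}szE addnK mulrC subrr.
  have lt_j : ((size Q).-1 < j)%N by rewrite ltn_neqAle eq_sym ne_j.
  have -> : Q`_j = 0 by apply: nth_default; rewrite -(prednK szQ).
  have lt_jm : ((size P).-1 < j - m)%N by lia.
  have -> : P`_(j - m) = 0 by apply: nth_default; rewrite -(prednK szP).
  by rewrite !mulr0 subrr.
have := IHn _ _ ltTQ GT Tx0; rewrite /T /T' !derivE !hornerE Px0 Qx0.
move=> evT; apply: (mulfI nz_c); rewrite mulr0 -[RHS]evT.
have -> : P'.[x] = - (P^`().[x] * x') by apply/eqP; rewrite -addr_eq0 evP.
by ring.
Qed.

End Theory.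

Lemma dual_graph_total (G0 : M -> M -> Prop) : dual_subring G0 ->
  exists G, [/\ dual_subring G, forall x y, G0 x y -> G x y &
                forall x, exists y, G x y].
Proof.
move=> dG0.
pose P (X : classical_sets.set (M * M)) := (forall w, ~ X w) \/
  (dual_subring (fun x y => X (x, y)) /\ (forall x y, G0 x y -> X (x, y))).
have [|X [PX maxX]] := @classical_sets.Zorn_bigcup (M * M)%type P.
  move=> F FP totF.
  have [[X0 [FX0 [w0 Xw0]]]|Fempty] :=
    boolp.EM (exists X, F X /\ exists w, X w); last first.
    left=> w [X FX Xw]; apply: Fempty; exists X; split=> //; by exists w.
  have goodF X w : F X -> X w ->
      dual_subring (fun x y => X (x, y)) /\ (forall x y, G0 x y -> X (x, y)).
    by move=> FX Xw; case: (FP X FX) => // /(_ _ Xw).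
  have [dX0 sX0] := goodF _ _ FX0 Xw0.
  have pairF x y x' y' : classical_sets.bigcup F id (x, x') ->
      classical_sets.bigcup F id (y, y') ->
      exists X, [/\ F X, dual_subring (fun x y => X (x, y)),
                    X (x, x') & X (y, y')].
    move=> [X FX Xx] [Y FY Yy].
    have [sXY|sYX] := totF _ _ FX FY.
      by exists Y; split=> //; [have [] := goodF _ _ FY Yy | apply: sXY].
    by exists X; split=> //; [have [] := goodF _ _ FX Xx | apply: sYX].
  right; split; last by move=> x y /sX0 Xxy; exists X0.
  split.
  - by exists X0 => //; apply: (dual1 dX0).
  - move=> x x' y y' Fx Fy; have [X [FX dX Xx Xy]] := pairF _ _ _ _ Fx Fy.
    by exists X => //; apply: (dualB dX).
  - move=> x x' y y' Fx Fy; have [X [FX dX Xx Xy]] := pairF _ _ _ _ Fx Fy.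
    by exists X => //; apply: (dualM dX).
  move=> x' Fx; have [X [FX dX Xx _]] := pairF _ _ _ _ Fx Fx.
  exact: (dual_functional dX).
pose X0 : classical_sets.set (M * M) := fun w => G0 w.1 w.2.
case: PX => [X_empty|[dX sX]].
  case: (maxX X0); last by right.
  split; first by move=> w /X_empty.
  by move/(_ (1, 0) (dual1 dG0))/X_empty.
exists (fun x y => X (x, y)); split=> // x.
have [x' dX'] := dual_adjoin_exists dX x.
exists x'; apply: boolp.contrapT => nXx.
case: (maxX (fun w => dual_adjoin (fun x y => X (x, y)) x x' w.1 w.2)).
  split; first by move=> -[y y'] Xy; apply: sub_dual_adjoin.
  by move/(_ (x, x') (dual_adjoin_gen dX _ _)).
right; split=> // y y' /sX; exact: sub_dual_adjoin.
Qed.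

End DualSubring.

Definition algebraic_along (R M : comNzRingType) (phi : R -> M) (z : M) :=
  exists2 P : {poly R}, P != 0 & (map_poly phi P).[z] = 0.

Lemma exists_leibniz (R : comNzRingType) (M : fieldType)
    (phi : {rmorphism R -> M}) (z : M) :
  [pchar M] =i pred0 -> ~ algebraic_along phi z ->
  exists D : {additive M -> M},
    [/\ leibniz idfun D, forall r, D (phi r) = 0 & D z = 1].
Proof.
move=> charM nalg.
have phi_inj r : phi r = 0 -> r = 0.
  move=> r0; apply: boolp.contrapT => /eqP nzr; case: nalg.
  by exists r%:P; rewrite ?polyC_eq0 // map_polyC hornerC.
pose G1 (x y : M) := exists2 r, x = phi r & y = 0.
have dG1 : dual_subring G1.
  split.
  - by exists 1; rewrite ?rmorph1.
  - by move=> _ _ _ _ [r -> ->] [s -> ->]; exists (r - s); rewrite ?rmorphB ?subr0.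
  - move=> _ _ _ _ [r -> ->] [s -> ->]; exists (r * s); rewrite ?rmorphM //.
    by rewrite mulr0 mul0r addr0.
  by move=> x' [].
have [|G [dG sG totG]] := dual_graph_total charM (G0 := dual_adjoin G1 z 1).
  apply: dual_subring_adjoin => // P P' GP Pz0.
  have P'0 : P' = 0 by apply/polyP=> i; rewrite coef0; have [] := GP i.
  have ex i : exists r, P`_i = phi r by have [r] := GP i; exists r.
  have [q qE] := boolp.choice ex; pose Q := \poly_(i < size P) q i.
  have defP : P = map_poly phi Q.
    apply/polyP => i; rewrite coef_map coef_poly.
    case: ltnP => [_|/(nth_default 0)->]; last by rewrite (raddf0 phi).
    exact: qE.
  have Q0 : Q = 0.
    apply: boolp.contrapT => /eqP nzQ; case: nalg.
    by exists Q; rewrite -?defP.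
  by rewrite P'0 defP Q0 rmorph0 deriv0 !horner0 mul0r addr0.
have funG x y y' : G x y -> G x y' -> y = y'.
  move=> Gy Gy'; apply/eqP; rewrite -subr_eq0; apply/eqP.
  by apply: (dual_functional dG); rewrite -(subrr x); apply: (dualB dG).
have [D GD] := boolp.choice totG.
have D_add : zmod_morphism D.
  by move=> x y; apply: (funG _ _ _ (GD _)); apply: (dualB dG).
pose DA : {additive M -> M} :=
  HB.pack D (GRing.isZmodMorphism.Build M M D D_add).
exists DA; split.
- by move=> x y; apply: (funG _ _ _ (GD _)); apply: (dualM dG).
- move=> r; apply: (funG _ _ _ (GD _)); apply/sG/(sub_dual_adjoin dG1).
  by exists r.
by apply: (funG _ _ _ (GD _)); apply/sG/(dual_adjoin_gen dG1).
Qed.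

Lemma leibniz_horner (M : comNzRingType) (D : {additive M -> M}) (P : {poly M}) z :
  leibniz idfun D -> (forall i, D P`_i = 0) -> D P.[z] = P^`().[z] * D z.
Proof.
move=> leibD; elim/poly_ind: P => [|P c IHP] DP0.
  by rewrite deriv0 !horner0 raddf0 mul0r.
have DPi i : D P`_i = 0.
  by have := DP0 i.+1; rewrite coefD coefMX coefC /= addr0.
have Dc : D c = 0 by have := DP0 0; rewrite coefD coefMX coefC /= add0r.
rewrite !derivE !hornerE raddfD leibD Dc IHP //=; ring.
Qed.

Lemma leibniz_algebraic (R : comNzRingType) (M : fieldType)
    (phi : {rmorphism R -> M}) (D : {additive M -> M}) z :
  [pchar M] =i pred0 -> injective phi -> leibniz idfun D ->
  (forall r, D (phi r) = 0) -> algebraic_along phi z -> D z = 0.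
Proof.
move=> charM phi_inj leibD Dphi [P nzP Pz0].
have : map_poly phi P != 0 by rewrite map_poly_eq0_id0 // raddf_eq0 ?lead_coef_eq0.
have : forall i, D (map_poly phi P)`_i = 0 by move=> i; rewrite coef_map Dphi.
move: Pz0; move: (map_poly phi P) => {nzP}P.
move: {2}(size P) (leqnn (size P)) => n.
elim: n P => [|n IHn] P le_n Pz0 DP0 nzP.
  by case/eqP: nzP; apply/eqP; rewrite -size_poly_leq0.
have /eqP := leibniz_horner z leibD DP0.
rewrite Pz0 raddf0 eq_sym mulf_eq0 => /orP[/eqP dPz0|/eqP//].
have [dP0|nzdP] := eqVneq P^`() 0.
  case/eqP: nzP; move: Pz0.
  by rewrite (deriv_eq0_pchar0 charM dP0) hornerC => ->.
apply: IHn nzdP => //; first by rewrite -ltnS (leq_trans (lt_size_deriv nzP)).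
by move=> i; rewrite coef_deriv raddfMn DP0 mul0rn.
Qed.

Lemma mpoly_ring_ind (R : comNzRingType) m (P : {mpoly R[m]} -> Prop) :
  (forall c, P c%:MP) -> (forall i, P 'X_i) ->
  (forall p q, P p -> P q -> P (p + q)) ->
  (forall p q, P p -> P q -> P (p * q)) -> forall p, P p.
Proof.
move=> PC PX PD PM p; rewrite [p]mpolyE.
apply: big_rec => [|mon q _ Pq]; first by rewrite -mpolyC0.
apply: (PD) => //; rewrite -mul_mpolyC; apply: (PM) => //.
rewrite mpolyXE_id; apply: big_rec => [|i r _ Pr]; first by rewrite -mpolyC1.
apply: (PM) => //; elim: (mon i) => [|e IHe]; first by rewrite expr0 -mpolyC1.
by rewrite exprS; apply: (PM).
Qed.

Lemma leibniz_mmap (R S T : comNzRingType) (h : {rmorphism R -> S})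
    (phi : {rmorphism S -> T}) (D : {additive S -> T}) m (x : 'I_m -> S)
    (p : {mpoly R[m]}) :
  leibniz phi D -> (forall c, D (h c) = 0) ->
  D (mmap h x p) = \sum_i phi (mmap h x p^`M(i)) * D (x i).
Proof.
move=> leibD Dh; elim/mpoly_ring_ind: p => [c|j|p q IHp IHq|p q IHp IHq].
- by rewrite mmapC Dh big1 // => i _; rewrite mderivC mmap0 rmorph0 mul0r.
- rewrite mmapX mmap1U (bigD1 j) //= big1 ?addr0 => [|i ne_ij].
    rewrite mderivX mnm1E eqxx scale1r -{1}[U_(j)%MM]add0m addmK.
    by rewrite mmapX mmap11 rmorph1 mul1r.
  rewrite mderivX mnm1E eq_sym (negPf ne_ij) scale0r mmap0 rmorph0 mul0r //.
- rewrite mmapD raddfD IHp IHq -big_split; apply: eq_bigr => i _.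
  by rewrite mderivD mmapD rmorphD mulrDl.
rewrite rmorphM leibD IHp IHq mulr_sumr mulr_suml -big_split /=.
apply: eq_bigr => i _; rewrite mderivM rmorphD rmorphD !rmorphM /=; ring.
Qed.

(** * Congruences and fixed points of contractions *)

Section Congruence.
Variable R : comNzRingType.
Implicit Types w x y : R.

Definition cong w x y := exists q, x - y = w * q.

Lemma cong_refl w x : cong w x x.
Proof. by exists 0; rewrite subrr mulr0. Qed.

Lemma congD w x x' y y' : cong w x x' -> cong w y y' -> cong w (x + y) (x' + y').
Proof. by move=> [p Ep] [q Eq]; exists (p + q); rewrite opprD addrACA Ep Eq mulrDr. Qed.

Lemma congM w x x' y y' : cong w x x' -> cong w y y' -> cong w (x * y) (x' * y').
Proof.
move=> [p Ep] [q Eq]; exists (p * y + x' * q).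
have -> : x * y - x' * y' = (x - x') * y + x' * (y - y') by ring.
by rewrite Ep Eq; ring.
Qed.

Lemma cong_sum w (I : Type) (s : seq I) (F G : I -> R) :
  (forall i, cong w (F i) (G i)) -> cong w (\sum_(i <- s) F i) (\sum_(i <- s) G i).
Proof.
move=> FG; elim: s => [|i s IHs]; first by rewrite !big_nil; apply: cong_refl.
by rewrite !big_cons; apply: congD.
Qed.

Lemma cong_lincomb0 w (I : Type) (s : seq I) (F G : I -> R) :
  (forall i, cong w (G i) 0) -> cong w (\sum_(i <- s) F i * G i) 0.
Proof.
move=> G0; rewrite -[X in cong w _ X](@big1 R 0 +%R I s xpredT (fun i => F i * 0)).
  by apply: cong_sum => i; apply: congM (cong_refl _ _) (G0 i).
by move=> i _; rewrite mulr0.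
Qed.

Lemma cong_mmap w (S : comNzRingType) (h : {rmorphism S -> R}) m
    (x y : 'I_m -> R) (p : {mpoly S[m]}) :
  (forall i, cong w (x i) (y i)) -> cong w (mmap h x p) (mmap h y p).
Proof.
move=> xy; elim/mpoly_ring_ind: p => [c|i|p q IHp IHq|p q IHp IHq].
- by rewrite !mmapC; apply: cong_refl.
- by rewrite !mmapX !mmap1U.
- by rewrite !mmapD; apply: congD.
by rewrite !rmorphM; apply: congM.
Qed.

End Congruence.

Lemma rmorph_mmap (R S T : comNzRingType) (h : {rmorphism R -> S})
    (phi : {rmorphism S -> T}) m (x : 'I_m -> S) (p : {mpoly R[m]}) :
  phi (mmap h x p) = mmap (phi \o h) (phi \o x) p.
Proof.
elim/mpoly_ring_ind: p => [c|i|p q IHp IHq|p q IHp IHq].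
- by rewrite !mmapC.
- by rewrite !mmapX !mmap1U.
- by rewrite !mmapD rmorphD IHp IHq.
by rewrite !rmorphM IHp IHq.
Qed.

Lemma mmap_ext (R S : comNzRingType) (h h' : R -> S) m (x x' : 'I_m -> S)
    (p : {mpoly R[m]}) : h =1 h' -> x =1 x' -> mmap h x p = mmap h' x' p.
Proof.
move=> hh' xx'; rewrite /mmap; apply: eq_bigr => mon _.
by rewrite hh' (mmap1_eq _ xx').
Qed.

Definition fps_agree (R : Type) m (F G : {fps R}) :=
  forall i, (i < m)%N -> F i = G i.

Lemma coef_fpsXnM (R : comNzRingType) m (F : {fps R}) i :
  (fps_of_poly 'X^m * F) i = if (i < m)%N then 0 else F (i - m)%N.
Proof.
rewrite coef_fpsM; case: ltnP => [lt_im|le_mi].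
  rewrite big1 // => j _; rewrite /= coefXn.
  by rewrite (ltn_eqF (leq_trans (ltn_ord j) lt_im)) mul0r.
rewrite (bigD1 (Ordinal (le_mi : (m < i.+1)%N))) //= coefXn eqxx mul1r.
rewrite big1 ?addr0 // => j ne_j.
by rewrite /= coefXn (_ : (_ == _) = false) ?mul0r //; apply: negPf.
Qed.

Lemma fps_agreeP (R : comNzRingType) m (F G : {fps R}) :
  fps_agree m F G <-> cong (fps_of_poly 'X ^+ m) F G.
Proof.
rewrite -rmorphXn /=; split=> [FG|[q /fpsP FGq] i lt_im].
  exists (Fps (fun i => F (i + m)%N - G (i + m)%N)); apply/fpsP => i.
  rewrite coef_fpsXnM coef_fpsB /=; case: ltnP => [/FG->|le_mi].
    by rewrite subrr.
  by rewrite subnK.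
apply/eqP; rewrite -subr_eq0 -coef_fpsB FGq; move: lt_im.
by rewrite coef_fpsXnM => ->.
Qed.

Lemma fps_fixpoint (R : zmodType) (I : Type)
    (Phi : (I -> {fps R}) -> I -> {fps R}) :
  (forall m F G, (forall i, fps_agree m (F i) (G i)) ->
     forall i, fps_agree m.+1 (Phi F i) (Phi G i)) ->
  exists F, (forall i, F i = Phi F i) /\
    forall G, (forall i, G i = Phi G i) -> forall i, G i = F i.
Proof.
move=> contr; pose X m := iter m Phi (fun=> 0).
have agreeX m d i : fps_agree m (X m i) (X (m + d)%N i).
  by elim: m i => [|m IHm] i //; rewrite addSn; apply: contr.
pose F i : {fps R} := Fps (fun m => X m.+1 i m).
have agreeF m i : fps_agree m (F i) (X m i).
  by move=> j lt_jm; rewrite /= -(subnKC lt_jm) -agreeX.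
have uniqF m G G' : (forall i, G i = Phi G i) -> (forall i, G' i = Phi G' i) ->
    forall i, fps_agree m (G i) (G' i).
  move=> fixG fixG'; elim: m => [|m IHm] i //.
  by rewrite fixG fixG'; apply: contr.
have fixF i : F i = Phi F i.
  apply/fpsP => m; rewrite (agreeF m.+1) //=.
  by apply: (contr m) => // j l lt_lm; rewrite -agreeF.
by exists F; split=> // G fixG i; apply/fpsP => m; apply: (uniqF m.+1).
Qed.

(** * K[[t]][u] inside K[u][[t]], and Weierstrass division *)

Section FpsSwap.
Variable R : comNzRingType.

Definition fps_swap (p : {poly {fps R}}) : {fps {poly R}} :=
  Fps (fun m => \poly_(j < size p) p`_j m).

Lemma coef_fps_swap p m j : (fps_swap p m)`_j = p`_j m.
Proof. by rewrite coef_poly; case: ltnP => // /(nth_default 0)->. Qed.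

Fact fps_swap_is_zmod_morphism : zmod_morphism fps_swap.
Proof.
move=> p q; apply/fpsP => m; apply/polyP => j.
by rewrite coef_fpsB coefB !coef_fps_swap coefB coef_fpsB.
Qed.

Lemma coef_fps_sum (S : zmodType) (I : Type) (s : seq I) (F : I -> {fps S}) m :
  (\sum_(i <- s) F i) m = \sum_(i <- s) F i m.
Proof. by elim: s => [|i s IHs]; rewrite ?big_nil // !big_cons coef_fpsD IHs. Qed.

Fact fps_swap_is_monoid_morphism : monoid_morphism fps_swap.
Proof.
split=> [|p q]; apply/fpsP => m; apply/polyP => j; rewrite coef_fps_swap.
  by rewrite !coef1 /=; case: j => [|j] /=; rewrite coef1; case: m => [|m];
     rewrite ?coef1 ?coef0.
rewrite coefM coef_fps_sum coef_fpsM coef_sum.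
under eq_bigr do rewrite coef_fpsM.
rewrite exchange_big /=; apply: eq_bigr => i _; rewrite coefM.
by apply: eq_bigr => l _; rewrite !coef_fps_swap.
Qed.

HB.instance Definition _ := GRing.isZmodMorphism.Build _ _ fps_swap
  fps_swap_is_zmod_morphism.
HB.instance Definition _ := GRing.isMonoidMorphism.Build _ _ fps_swap
  fps_swap_is_monoid_morphism.

Lemma fps_swap_inj : injective fps_swap.
Proof.
move=> p q /fpsP pq; apply/polyP => j; apply/fpsP => m.
by rewrite -!coef_fps_swap pq.
Qed.

Lemma fps_swap_map (s : {poly {poly R}}) :
  fps_swap (map_poly (@fps_of_poly R) s) = fps_of_poly (swapXY s).
Proof.
apply/fpsP => m; apply/polyP => j.
by rewrite coef_fps_swap coef_map /= coef_swapXY.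
Qed.

Lemma fps_swapC (c : {fps R}) m : fps_swap c%:P m = (c m)%:P.
Proof.
apply/polyP => j; rewrite coef_fps_swap !coefC.
by case: eqP.
Qed.

Lemma size_fps_swap p m : (size (fps_swap p m) <= size p)%N.
Proof. exact: size_poly. Qed.

Lemma fps_swap_monic p : p \is monic ->
  fps_swap p 0 \is monic /\ size (fps_swap p 0) = size p.
Proof.
move=> mon_p; have p_gt0 : (0 < size p)%N by rewrite size_poly_gt0 monic_neq0.
have lead1 : (fps_swap p 0)`_(size p).-1 = 1.
  by rewrite coef_fps_swap -[p`_ _]/(lead_coef p) (monicP mon_p) /= coef1.
have szE : size (fps_swap p 0) = size p.
  apply/eqP; rewrite eqn_leq size_fps_swap leqNgt; apply/negP => lt_p.
  move: lead1; rewrite nth_default => [/eqP|]; first by rewrite eq_sym oner_eq0.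
  by rewrite -ltnS prednK.
by split=> //; rewrite monicE /lead_coef szE lead1.
Qed.

Lemma fps_swap_surj N (F : {fps {poly R}}) : (forall m, (size (F m) <= N)%N) ->
  exists2 p, fps_swap p = F & (size p <= N)%N.
Proof.
move=> szF; exists (\poly_(j < N) Fps (fun m => (F m)`_j)); last exact: size_poly.
apply/fpsP => m; apply/polyP => j; rewrite coef_fps_swap coef_poly.
by case: ltnP => // leNj; rewrite coef_fps0 nth_default // (leq_trans (szF m)).
Qed.

End FpsSwap.

Section Weierstrass.
Variable K : fieldType.
Implicit Types (g F : {fps {poly K}}) (p r W : {poly {fps K}}).

Lemma weierstrass_division g F : g 0 \is monic ->
  exists q r, F = q * g + fps_swap r /\ (size r < size (g 0%N))%N.
Proof.
move=> mon_g; pose rest (q : {fps {poly K}}) m := F m - \sum_(i < m) q i * g (m - i)%N.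
pose Phi (q : unit -> {fps {poly K}}) (_ : unit) : {fps {poly K}} :=
  Fps (fun m => rest (q tt) m %/ g 0%N).
have [|q [/(_ tt)/fpsP fix_q _]] := @fps_fixpoint _ unit Phi.
  move=> m q q' qq' _ j lt_jm /=; congr (_ %/ _); congr (_ - _).
  apply: eq_bigr => i _; rewrite qq' //.
  exact: leq_trans (ltn_ord i) _.
have g_gt0 : (0 < size (g 0%N))%N by rewrite size_poly_gt0 monic_neq0.
have [|r Er szr] := @fps_swap_surj K (size (g 0%N)).-1
    (Fps (fun m => rest (q tt) m %% g 0%N)).
  by move=> m /=; rewrite -ltnS prednK // ltn_modp monic_neq0.
exists (q tt), r; split; last by rewrite -(prednK g_gt0) ltnS.
apply/fpsP => m; rewrite coef_fpsD coef_fpsM Er big_ord_recr /= subnn.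
rewrite fix_q /= -addrA -divp_eq /rest addrC subrK //.
Qed.

Lemma weierstrass_unique g F r : g 0 \is monic ->
  (size r < size (g 0%N))%N -> fps_swap r = g * F -> F = 0.
Proof.
move=> mon_g lt_r /fpsP rE; have [//|/fps_order[i nzFi F0]] := eqVneq F 0.
have rEi : fps_swap r i = g 0%N * F i.
  rewrite rE coef_fpsM big_ord_recl /= subn0 big1 ?addr0 // => j _.
  by rewrite F0 ?mulr0 // /bump; have := ltn_ord j; lia.
have := size_fps_swap r i; rewrite rEi.
rewrite leqNgt (leq_trans lt_r) // dvdp_leq ?mulf_neq0 ?(monic_neq0 mon_g) //.
exact: dvdp_mulIl.
Qed.

Lemma fps_swap_dvd W p : W \is monic ->
  (exists F, fps_swap p = fps_swap W * F) -> exists q, p = q * W.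
Proof.
move=> monW [F pE]; have [mon0 sz0] := fps_swap_monic monW.
have eq_p := Pdiv.RingMonic.rdivp_eq monW p.
exists (Pdiv.Ring.rdivp p W); rewrite {1}eq_p.
suff -> : Pdiv.Ring.rmodp p W = 0 by rewrite addr0.
apply: fps_swap_inj; rewrite raddf0.
have modE : fps_swap (Pdiv.Ring.rmodp p W) =
    fps_swap W * (F - fps_swap (Pdiv.Ring.rdivp p W)).
  by rewrite mulrBr -pE {2}eq_p rmorphD rmorphM /=; ring.
rewrite modE (weierstrass_unique mon0 _ modE) ?mulr0 // sz0.
by rewrite Pdiv.Ring.ltn_rmodp monic_neq0.
Qed.

Lemma weierstrass_multiple g : g 0 \is monic ->
  exists2 W, W \is monic & exists F, fps_swap W = g * F.
Proof.
move=> mon_g; have [q [r [qE szr]]] :=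
  weierstrass_division (fps_swap 'X^((size (g 0%N)).-1)) mon_g.
have g_gt0 : (0 < size (g 0%N))%N by rewrite size_poly_gt0 monic_neq0.
exists ('X^((size (g 0%N)).-1) - r); last first.
  by exists q; rewrite rmorphB /= qE addrK mulrC.
rewrite monicE lead_coefDl ?lead_coefXn // size_polyXn size_polyN.
by rewrite prednK.
Qed.

End Weierstrass.

Lemma common_denominator (R : idomainType) (s : seq {poly {fraction R}}) :
  exists2 c : R, c != 0 & forall p, p \in s ->
    exists q, (FracField.tofrac c)%:P * p = map_poly (@FracField.tofrac R) q.
Proof.
have scal (x : {fraction R}) :
    exists2 c : R, c != 0 & exists q, FracField.tofrac c * x = FracField.tofrac q.
  have [p [q [nzq ->]]] := fracW x; exists q => //; exists p.
  by rewrite mulrC divfK // tofrac_eq0.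
have scalp (p : {poly {fraction R}}) : exists2 c : R, c != 0 &
    exists q, (FracField.tofrac c)%:P * p = map_poly (@FracField.tofrac R) q.
  elim/poly_ind: p => [|p x [c nzc [q qE]]].
    by exists 1; rewrite ?oner_eq0 //; exists 0; rewrite mulr0 rmorph0.
  have [d nzd [y yE]] := scal x; exists (c * d); first by rewrite mulf_neq0.
  exists (d%:P * q * 'X + (c * y)%:P); rewrite rmorphD !rmorphM /= map_polyX.
  rewrite !map_polyC /= -qE -yE ?tofracM ?polyCM; ring.
elim: s => [|p s [c nzc IHs]]; first by exists 1; rewrite ?oner_eq0.
have [d nzd [q qE]] := scalp p; exists (c * d); first by rewrite mulf_neq0.
move=> p'; rewrite inE => /orP[/eqP->|/IHs[q' q'E]].
  by exists (c%:P * q); rewrite [RHS]rmorphM /= map_polyC /= -qE ?tofracM ?polyCM; ring.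
by exists (d%:P * q'); rewrite [RHS]rmorphM /= map_polyC /= -q'E ?tofracM ?polyCM; ring.
Qed.

(** * Polynomial systems with unknowns in K[u][[t]] and in K[[t]] *)

Definition glue (T : Type) n r (H : 'I_n -> T) (z : 'I_r -> T) (p : 'I_(n + r)) :=
  match split p with inl j => H j | inr l => z l end.

Lemma glue_lshift (T : Type) n r (H : 'I_n -> T) (z : 'I_r -> T) j :
  glue H z (lshift r j) = H j.
Proof. by rewrite /glue (unsplitK (inl j)). Qed.

Lemma glue_rshift (T : Type) n r (H : 'I_n -> T) (z : 'I_r -> T) l :
  glue H z (rshift n l) = z l.
Proof. by rewrite /glue (unsplitK (inr l)). Qed.

Lemma sum_glue (R : pzSemiRingType) n r (E : 'I_(n + r) -> R) H z :
  \sum_p E p * glue H z p =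
  \sum_j E (lshift r j) * H j + \sum_l E (rshift n l) * z l.
Proof.
rewrite big_split_ord /=; congr (_ + _); apply: eq_bigr => i _.
  by rewrite glue_lshift.
by rewrite glue_rshift.
Qed.

Section System.
Variable K : fieldType.
Hypothesis pcharK : [pchar K] =i pred0.

Local Notation A := {fps {poly K}}.
Local Notation B := {poly {fps K}}.
(* K[t][u], with u the outer variable *)
Local Notation S := {poly {poly K}}.
Local Notation tofrac := (@FracField.tofrac _).
Local Notation sigma := (map_poly (@fps_of_poly K)).

Definition embed_tu : S -> A := @fps_swap K \o sigma.
Arguments embed_tu : simpl never.
HB.instance Definition _ := GRing.RMorphism.copy embed_tu (@fps_swap K \o sigma).

Lemma pchar_frac (R : idomainType) (phi : {rmorphism K -> R}) :
  [pchar {fraction R}] =i pred0.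
Proof.
by move=> p; rewrite (fmorph_pchar (tofrac \o phi)) pcharK.
Qed.

Lemma pchar_frac_fps : [pchar {fraction {fps K}}] =i pred0.
Proof. exact: (pchar_frac (@fps_of_poly K \o polyC)). Qed.

Lemma pchar_frac_fps_poly : [pchar {fraction {fps {poly K}}}] =i pred0.
Proof. exact: (pchar_frac (@fps_of_poly {poly K} \o (polyC \o polyC))). Qed.

Variables (n r : nat) (e : 'I_n -> {mpoly S[n + r]}).
Variables (H : 'I_n -> A) (z : 'I_r -> {fps K}).

Let x : 'I_(n + r) -> A := glue H (fun l => fps_swap (z l)%:P).
Let E i p := mmap embed_tu x (e i)^`M(p).
Let J := \matrix_(i < n, j < n) E i (lshift r j).

Hypothesis sol_e : forall i, mmap embed_tu x (e i) = 0.
Hypothesis monic_J : (\det J) 0%N \is monic.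

Lemma linearized_solution (D : {additive {fraction {fps K}} -> {fraction {fps K}}}) :
  leibniz idfun D -> (forall s : {poly K}, D (tofrac (fps_of_poly s)) = 0) ->
  exists2 c, c != 0 & exists zeta G,
    (forall l, tofrac c * D (tofrac (z l)) = tofrac (zeta l)) /\
    forall i, \sum_p E i p * glue G (fun l => fps_swap (zeta l)%:P) p = 0.
Proof.
move=> leibD D0.
have [W monW [W1 WE]] := weierstrass_multiple monic_J.
have [mon2 _] := fps_swap_monic (monic_exp 2 monW).
have exh j : exists h, cong (fps_swap (W ^+ 2)) (fps_swap h) (H j).
  have [q [h [-> _]]] := weierstrass_division (H j) mon2.
  by exists h, (- q); ring.
have [h hP] := boolp.choice exh.
pose x' : 'I_(n + r) -> B := glue h (fun l => (z l)%:P).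
have xx' p : cong (fps_swap (W ^+ 2)) (fps_swap (x' p)) (x p).
  rewrite /x' /x /glue; case: split => [j|l]; last exact: cong_refl.
  exact: hP.
have ev q : cong (fps_swap (W ^+ 2)) (fps_swap (mmap sigma x' q)) (mmap embed_tu x q).
  rewrite (rmorph_mmap sigma (@fps_swap K)).
  exact: (cong_mmap embed_tu).
have exy i : exists y, mmap sigma x' (e i) = y * W ^+ 2.
  apply: fps_swap_dvd; first exact: monic_exp.
  by have [q qE] := ev (e i); exists q; rewrite -qE sol_e subr0.
have [y yE] := boolp.choice exy.
pose tau : {rmorphism B -> {poly {fraction {fps K}}}} :=
  map_poly (@FracField.tofrac {fps K}).
pose delta : {additive B -> {poly {fraction {fps K}}}} :=
  map_poly (D \o @FracField.tofrac {fps K}).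
have leib_delta : leibniz tau delta.
  move=> p q; apply/polyP => i; rewrite coefD !coefM coef_map /= coefM.
  rewrite !raddf_sum -big_split /=; apply: eq_bigr => j _.
  by rewrite !coef_map /= tofracM leibD.
have delta0 s : delta (sigma s) = 0.
  by apply/polyP => i; rewrite !coef_map /= D0 coef0.
pose w i := tau (y i) * (delta W + delta W) + delta (y i) * tau W.
have deltaE i :
    \sum_p tau (mmap sigma x' (e i)^`M(p)) * delta (x' p) = tau W * w i.
  rewrite -(leibniz_mmap x' _ leib_delta delta0) yE leib_delta expr2 leib_delta.
  by rewrite rmorphM /w; ring.
have [c nzc cP] := common_denominator (codom (delta \o x') ++ codom w).
have exg p : exists g, (tofrac c)%:P * delta (x' p) = tau g.
  by apply: cP; rewrite mem_cat (codom_f (delta \o x')).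
have [g gE] := boolp.choice exg.
have exo i : exists o, (tofrac c)%:P * w i = tau o.
  by apply: cP; rewrite mem_cat codom_f orbT.
have tau_inj : injective tau.
  by apply: map_inj_poly; rewrite ?tofrac0 // => ? ? /eqP; rewrite tofrac_eq => /eqP.
have exs i : exists s, \sum_p E i p * fps_swap (g p) = \det J * s.
  have [o oE] := exo i.
  have gW : \sum_p mmap sigma x' (e i)^`M(p) * g p = W * o.
    apply: tau_inj; rewrite rmorphM -oE mulrCA -deltaE mulr_sumr rmorph_sum.
    by apply: eq_bigr => p _; rewrite rmorphM -gE mulrCA.
  have [q qE] : cong (fps_swap (W ^+ 2))
      (\sum_p fps_swap (mmap sigma x' (e i)^`M(p)) * fps_swap (g p))
      (\sum_p E i p * fps_swap (g p)).
    by apply: cong_sum => p; apply: congM (cong_refl _ _); apply: ev.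
  exists (W1 * (fps_swap o - fps_swap W * q)).
  rewrite mulrA -WE mulrBr -rmorphM -gW rmorph_sum mulrA -expr2 -rmorphXn -qE.
  rewrite [X in X - _](_ : _ = \sum_p fps_swap (mmap sigma x' (e i)^`M(p)) * fps_swap (g p)).
    by rewrite opprB addrC subrK.
  by apply: eq_bigr => p _; rewrite rmorphM.
have [s sE] := boolp.choice exs.
have gz l : g (rshift n l) = ((g (rshift n l))`_0)%:P.
  apply: tau_inj; rewrite -gE /x' glue_rshift /delta /tau /= !map_polyC /=.
  rewrite -polyCM; congr (_%:P).
  have := congr1 (fun q : {poly _} => q`_0) (gE (rshift n l)).
  by rewrite /x' glue_rshift /delta /tau /= map_polyC /= -polyCM coefC coef_map.
pose gv := \col_j fps_swap (g (lshift r j)).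
pose G := gv - \adj J *m \col_i s i.
exists c => //; exists (fun l => (g (rshift n l))`_0), (fun j => G j 0); split.
  move=> l; have := congr1 (fun q : {poly _} => q`_0) (gE (rshift n l)).
  by rewrite /x' glue_rshift /delta /tau /= map_polyC /= -polyCM coefC coef_map.
move=> i; rewrite sum_glue; under [X in _ + X]eq_bigr do rewrite -gz.
have -> : \sum_j E i (lshift r j) * G j 0 = (J *m G) i 0.
  by rewrite [RHS]mxE; apply: eq_bigr => j _; rewrite [J _ _]mxE.
have -> : (J *m G) i 0 = (J *m gv) i 0 - \det J * s i.
  by rewrite mulmxBr mulmxA mul_mx_adj mul_scalar_mx !mxE.
rewrite -sE big_split_ord /= mxE.
under [X in X - _]eq_bigr do rewrite !mxE.
by rewrite opprD addrA subrr sub0r addNr.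
Qed.

Hypothesis linearized_trivial : forall zeta G,
  (forall i, \sum_p E i p * glue G (fun l => fps_swap (zeta l)%:P) p = 0) ->
  forall l, zeta l = 0.

Lemma map_poly_horner_tofrac (R : comNzRingType) (T : idomainType)
    (phi : {rmorphism R -> T}) (P : {poly R}) y :
  (map_poly (tofrac \o phi) P).[tofrac y] = tofrac (map_poly phi P).[y].
Proof. by rewrite map_poly_comp horner_map. Qed.

Lemma algebraic_parameter l : algebraic_along (@fps_of_poly K) (z l).
Proof.
apply: boolp.contrapT => nalg.
have [|D [leibD D0 Dz]] := exists_leibniz (phi := tofrac \o @fps_of_poly K)
    (z := tofrac (z l)) pchar_frac_fps.
  move=> [P nzP /eqP]; rewrite map_poly_horner_tofrac tofrac_eq0 => /eqP Pz.
  by case: nalg; exists P.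
have [c nzc [zeta [G [zetaE /linearized_trivial zeta0]]]] :=
  linearized_solution leibD D0.
have /eqP := zetaE l; rewrite Dz mulr1 zeta0 tofrac0 tofrac_eq0.
by rewrite (negPf nzc).
Qed.

Lemma algebraic_unknown j : algebraic_along embed_tu (H j).
Proof.
apply: boolp.contrapT => nalg.
have [|D [leibD D0 DH]] := exists_leibniz (phi := tofrac \o embed_tu)
    (z := tofrac (H j)) pchar_frac_fps_poly.
  move=> [P nzP /eqP]; rewrite map_poly_horner_tofrac tofrac_eq0 => /eqP PH.
  by case: nalg; exists P.
pose phi : {rmorphism {poly K} -> {fraction A}} :=
  tofrac \o (@fps_swap K \o (polyC \o @fps_of_poly K)).
have phi_inj : injective phi.
  move=> p q /eqP; rewrite tofrac_eq => /eqP /fps_swap_inj /polyC_inj.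
  exact: fps_of_poly_inj.
have Dz l : D (tofrac (fps_swap (z l)%:P)) = 0.
  apply: (leibniz_algebraic (phi := phi)) => // [|p|]; first exact: pchar_frac_fps_poly.
    by have := D0 p%:P; rewrite /= /embed_tu /= map_polyC.
  have [P nzP Pz] := algebraic_parameter l; exists P => //.
  rewrite map_poly_horner_tofrac map_poly_comp horner_map /=.
  by rewrite map_poly_comp horner_map /= Pz rmorph0 tofrac0.
pose Dt : {additive A -> {fraction A}} := D \o @FracField.tofrac A.
have leibDt : leibniz (@FracField.tofrac A) Dt.
  by move=> p q; rewrite /Dt /= tofracM leibD.
pose dH := \col_j Dt (H j).
have JdH : map_mx (@FracField.tofrac A) J *m dH = 0.
  apply/colP => i; rewrite !mxE.
  transitivity (\sum_p tofrac (E i p) * glue (Dt \o H) (fun=> 0) p).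
    rewrite sum_glue [X in _ = _ + X]big1 ?addr0 => [|l _]; last exact: mulr0.
    by apply: eq_bigr => j' _; rewrite !mxE.
  rewrite -[RHS](raddf0 Dt) -(sol_e i) (leibniz_mmap x (e i) leibDt D0).
  apply: eq_bigr => p _; congr (_ * _); rewrite /x /glue; case: split => // l.
  by rewrite /Dt /= Dz.
have /(congr1 (fun M : 'cV_n => M j 0)) : tofrac (\det J) *: dH = 0.
  rewrite -det_map_mx -mul_scalar_mx -mul_adj_mx -mulmxA JdH mulmx0 //.
rewrite !mxE /Dt /= DH mulr1 => /eqP; rewrite tofrac_eq0 => /eqP detJ0.
by have := monic_neq0 monic_J; rewrite detJ0 coef_fps0 eqxx.
Qed.

End System.

(** * The catalytic system *)

Definition catalytic_args (T : Type) n k (Y : 'I_n -> nat -> T) (t u : T) : seq T :=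
  flatten [seq [seq Y i j | j <- iota 0 k.+1] | i <- enum 'I_n] ++ [:: t; u].

Lemma nth_catalytic_args_rel (T T' : Type) (P : T -> T' -> Prop) n k
    (Y : 'I_n -> nat -> T) (Y' : 'I_n -> nat -> T') t u t' u' x0 x0' v :
  P x0 x0' -> (forall i j, (j <= k)%N -> P (Y i j) (Y' i j)) -> P t t' -> P u u' ->
  P (nth x0 (catalytic_args k Y t u) v) (nth x0' (catalytic_args k Y' t' u') v).
Proof.
move=> P0 PY Pt Pu; pose Ps s s' :=
  size s = size s' /\ forall v, P (nth x0 s v) (nth x0' s' v).
have Ps_nil : Ps [::] [::] by split=> // w; rewrite !nth_nil.
have Ps_cons y y' s s' : P y y' -> Ps s s' -> Ps (y :: s) (y' :: s').
  by move=> Py [szs ns]; split=> [|[|w]] //=; rewrite szs.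
have Ps_cat s1 s1' s2 s2' : Ps s1 s1' -> Ps s2 s2' -> Ps (s1 ++ s2) (s1' ++ s2').
  move=> [sz1 n1] [sz2 n2]; split=> [|w]; first by rewrite !size_cat sz1 sz2.
  by rewrite !nth_cat sz1; case: ifP.
suff [] : Ps (catalytic_args k Y t u) (catalytic_args k Y' t' u') by [].
apply: (Ps_cat); last by apply: (Ps_cons) => //; apply: (Ps_cons).
elim: (enum 'I_n) => //= i s IHs; apply: (Ps_cons); first exact: PY.
apply: (Ps_cat) => // {IHs}.
have : forall j, j \in iota 1 k -> (j <= k)%N by move=> j; rewrite mem_iota; lia.
elim: (iota 1 k) => //= j l IHl le_k; apply: (Ps_cons).
  by apply: PY; apply: le_k; rewrite mem_head.
by apply: IHl => j' l_j'; apply: le_k; rewrite in_cons l_j' orbT.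
Qed.

Section TaylorPart.
Variables (C : comNzRingType) (k : nat).

(* The value of [Delta^j F] when [F = \sum_(l < k) v^l z_l + v^k h], where
   [v = u - a] and the [z_l] do not involve [u]. *)
Definition taylor_shift (v h : C) (z : 'I_k -> C) j : C :=
  \sum_(l < k | (j <= l)%N) v ^+ (l - j) * z l + v ^+ (k - j) * h.

Lemma taylor_shift_rec v h z (j : 'I_k) :
  taylor_shift v h z j = z j + v * taylor_shift v h z j.+1.
Proof.
rewrite /taylor_shift (bigD1 j) //= subnn mul1r -addrA; congr (_ + _).
rewrite mulrDr mulrA -exprS subnSK // mulr_sumr; congr (_ + _).
rewrite (eq_bigl (fun l : 'I_k => (j < l)%N)) => [|l]; last first.
  by rewrite ltn_neqAle andbC eq_sym.
by apply: eq_bigr => l lt_jl; rewrite mulrA -exprS subnSK.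
Qed.

Lemma taylor_shift_end v h z : taylor_shift v h z k = h.
Proof.
rewrite /taylor_shift subnn mul1r big1 ?add0r // => l.
by rewrite leqNgt ltn_ord.
Qed.

End TaylorPart.

Lemma additive_taylor_shift (C C' : comNzRingType) k (D : {additive C -> C'})
    (v h : C) (v' : C') (z : 'I_k -> C) j :
  (forall m y, D (v ^+ m * y) = v' ^+ m * D y) ->
  D (taylor_shift v h z j) = taylor_shift v' (D h) (D \o z) j.
Proof.
move=> Dv; rewrite /taylor_shift raddfD raddf_sum /= Dv; congr (_ + _).
by apply: eq_bigr => l _; rewrite Dv.
Qed.

Section Catalytic.
Variables (K : fieldType) (a : K).

Local Notation A := {fps {poly K}}.
Local Notation S := {poly {poly K}}.
Local Notation tofrac := (@FracField.tofrac _).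
Local Notation v := (fps_u K - fps_const a).
Local Notation const_u c := (@fps_swap K c%:P).

Lemma system_argsE k n (F : 'I_n -> A) :
  system_args a k F =
  catalytic_args k (fun i j => iter j (Delta a) (F i)) (fps_t K) (fps_u K).
Proof.
congr (flatten _ ++ _); apply: eq_map => i.
apply: (@eq_from_nth _ (F i)) => [|j]; rewrite size_traject; first by rewrite size_map size_iota.
by move=> lt_jk; rewrite /nabla nth_traject // (nth_map 0%N) ?size_iota // nth_iota.
Qed.

Lemma Delta_agree m F G : fps_agree m F G -> fps_agree m (Delta a F) (Delta a G).
Proof. by move=> FG i lt_im /=; rewrite FG. Qed.

Lemma iter_Delta_agree m j F G :
  fps_agree m F G -> fps_agree m (iter j (Delta a) F) (iter j (Delta a) G).
Proof. by move=> FG; elim: j => //= j; apply: Delta_agree. Qed.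

Lemma iter_Delta0 j : iter j (Delta a) 0 = 0.
Proof.
elim: j => //= j ->; apply/fpsP => m /=.
by rewrite horner0 subrr div0p.
Qed.

Lemma catalytic_fixpoint k n (f : 'I_n -> {poly K})
    (Q : 'I_n -> {mpoly K[n * k.+1 + 2]}) :
  exists F, is_solution a f Q F /\ forall G, is_solution a f Q G -> G =1 F.
Proof.
pose Phi F i := fps_of_poly (f i)%:P + fps_t K * eval_system a (Q i) F.
have [|F [fixF uniqF]] := @fps_fixpoint _ 'I_n Phi; last by exists F.
move=> m F G FG i; apply/fps_agreeP; apply: congD; first exact: cong_refl.
suff [q qE] : cong (fps_t K ^+ m) (eval_system a (Q i) F) (eval_system a (Q i) G).
  by exists q; rewrite -mulrBr qE exprS mulrA.
rewrite /eval_system; apply: (cong_mmap (@fps_of_poly {poly K} \o (polyC \o polyC))).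
move=> w; rewrite !system_argsE; apply: nth_catalytic_args_rel; try exact: cong_refl.
by move=> i' j _; apply/fps_agreeP/iter_Delta_agree.
Qed.

Lemma embed_tuE (s : S) : embed_tu s = fps_of_poly (swapXY s).
Proof. exact: fps_swap_map. Qed.

Lemma embed_tu_u : embed_tu ('X : S) = fps_u K.
Proof. by rewrite embed_tuE swapXY_X. Qed.

Lemma embed_tu_t : embed_tu ('X%:P : S) = fps_t K.
Proof. by rewrite embed_tuE swapXY_Y. Qed.

Lemma embed_tu_const (c : K) : embed_tu (c%:P%:P : S) = fps_const c.
Proof. by rewrite embed_tuE swapXY_polyC map_polyC. Qed.

Lemma embed_tu_poly_u (p : {poly K}) :
  embed_tu (map_poly polyC p) = fps_of_poly p%:P.
Proof. by rewrite embed_tuE swapXY_map_polyC. Qed.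

Lemma embed_tu_v : embed_tu ('X - a%:P%:P : S) = v.
Proof.
by rewrite embed_tuE swapXY_is_zmod_morphism swapXY_X swapXY_polyC map_polyC -polyCB fps_u_const.
Qed.

Lemma Delta_taylor_shift k (h : A) (z : 'I_k -> {fps K}) j : (j < k)%N ->
  Delta a (taylor_shift v h (fun l => const_u (z l)) j) =
  taylor_shift v h (fun l => const_u (z l)) j.+1.
Proof.
move=> lt_jk; apply/esym/Delta_unique.
rewrite (taylor_shift_rec _ _ _ (Ordinal lt_jk)) /= addrAC.
rewrite -[LHS]add0r; congr (_ + _); apply/esym/eqP; rewrite subr_eq0; apply/eqP.
apply/fpsP => m; rewrite fps_swapC; congr (_%:P).
by rewrite coef_fpsD fps_u_const coef_fpsCM fps_swapC !hornerE subrr mul0r addr0.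
Qed.

Lemma iter_Delta_taylor_shift k (h : A) (z : 'I_k -> {fps K}) j : (j <= k)%N ->
  iter j (Delta a) (taylor_shift v h (fun l => const_u (z l)) 0) =
  taylor_shift v h (fun l => const_u (z l)) j.
Proof.
elim: j => //= j IHj lt_jk; rewrite IHj ?(ltnW lt_jk) //.
exact: Delta_taylor_shift.
Qed.

Lemma taylor_decomposition k (F : A) : exists (h : A) (z : 'I_k -> {fps K}),
  F = taylor_shift v h (fun l => const_u (z l)) 0.
Proof.
pose z l : {fps K} := Fps (fun m => (iter l (Delta a) F m).[a]).
exists (iter k (Delta a) F), (fun l => z l).
suff shiftE d j : (d + j = k)%N -> iter j (Delta a) F =
    taylor_shift v (iter k (Delta a) F) (fun l : 'I_k => const_u (z l)) j.
  exact: (shiftE k 0%N (addn0 k)).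
elim: d j => [|d IHd] j; first by rewrite add0n => ->; rewrite taylor_shift_end.
move=> djk; have lt_jk : (j < k)%N by lia.
rewrite (taylor_shift_rec _ _ _ (Ordinal lt_jk)) /= -IHd; last by lia.
rewrite iterS Delta_spec addrC -[LHS](subrK (eval_u a (iter j (Delta a) F))).
by congr (_ + _); apply/fpsP => m; rewrite fps_swapC.
Qed.

Lemma mderiv_gen (R : comNzRingType) m (p q : 'I_m) :
  ('X_q : {mpoly R[m]})^`M(p) = (p == q)%:R.
Proof.
rewrite mderivX mnm1E eq_sym; case: eqP => [->|_]; last by rewrite scale0r.
by rewrite scale1r -{1}[U_(q)%MM]add0m addmK mpolyX0.
Qed.

Lemma mpolyC_exp (R : comNzRingType) m (c : R) j :
  (c ^+ j)%:MP_[m] = c%:MP ^+ j.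
Proof. exact: rmorphXn. Qed.

Section PolynomialSystem.
Variables (n k : nat) (f : 'I_n -> {poly K}) (Q : 'I_n -> {mpoly K[n * k.+1 + 2]}).
Variables (H : 'I_n -> A) (z : 'I_n -> 'I_k -> {fps K}).

Local Notation T := {mpoly S[n + n * k]}.

Definition shift_var (i : 'I_n) j : T :=
  taylor_shift ('X - a%:P%:P)%:MP 'X_(lshift (n * k) i)
    (fun l => 'X_(rshift n (mxvec_index i l))) j.

Definition const_var : K -> T := @mpolyC (n + n * k) S \o (polyC \o polyC).
HB.instance Definition _ :=
  GRing.RMorphism.copy const_var (@mpolyC (n + n * k) S \o (polyC \o polyC)).

Definition rhs_var (i : 'I_n) : T :=
  mmap const_var
    (fun w => (catalytic_args k shift_var ('X%:P)%:MP ('X : S)%:MP)`_w) (Q i).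

Definition equation_var (i : 'I_n) : T :=
  shift_var i 0 - (map_poly polyC (f i))%:MP - ('X%:P : S)%:MP * rhs_var i.

Definition taylor_index (p : 'I_(n * k)) : {fps K} :=
  mxvec (\matrix_(i < n, l < k) z i l) 0 p.

Local Notation x := (glue H (fun p => const_u (taylor_index p))).
Local Notation F := (fun i => taylor_shift v (H i) (fun l => const_u (z i l)) 0).
Local Notation ev := (mmap (@embed_tu K) x).

Lemma ev_shift_var i j :
  ev (shift_var i j) = taylor_shift v (H i) (fun l => const_u (z i l)) j.
Proof.
rewrite (@additive_taylor_shift _ _ _ _ _ _ v) => [|m y]; last first.
  by rewrite /= rmorphM rmorphXn /= mmapC /= embed_tu_v.
rewrite /= mmapX mmap1U glue_lshift; congr (_ + _); apply: eq_bigr => l _ /=.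
by rewrite mmapX mmap1U glue_rshift /taylor_index mxvecE mxE.
Qed.

Lemma ev_equation i : is_solution a f Q F -> ev (equation_var i) = 0.
Proof.
move=> solF; rewrite 2!mmapB mmapC rmorphM /= mmapC /= embed_tu_t embed_tu_poly_u.
rewrite ev_shift_var (solF i : taylor_shift _ _ _ 0 = _).
rewrite [fps_of_poly _ + _]addrC addrK -mulrBr; apply/eqP; rewrite mulf_eq0 subr_eq0; apply/orP; right.
apply/eqP; rewrite /eval_system /rhs_var rmorph_mmap system_argsE.
apply: mmap_ext => [c|w] /=; first by rewrite mmapC /= embed_tu_const.
apply: (nth_catalytic_args_rel (P := fun y q => y = ev q)).
- by rewrite mmap0.
- by move=> i' j le_jk; rewrite ev_shift_var iter_Delta_taylor_shift.
- by rewrite mmapC /= embed_tu_t.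
by rewrite mmapC /= embed_tu_u.
Qed.

Local Notation E i p := (ev (equation_var i)^`M(p)).

Definition const_coef (G : A) : {poly K} := G 0%N.
Arguments const_coef : simpl never.
Fact const_coef_is_zmod_morphism : zmod_morphism const_coef.
Proof. by []. Qed.
Fact const_coef_is_monoid_morphism : monoid_morphism const_coef.
Proof.
split=> [|G G']; first by rewrite /const_coef /= coef1.
by rewrite /const_coef coef_fpsM big_ord1.
Qed.
HB.instance Definition _ :=
  GRing.isZmodMorphism.Build _ _ const_coef const_coef_is_zmod_morphism.
HB.instance Definition _ :=
  GRing.isMonoidMorphism.Build _ _ const_coef const_coef_is_monoid_morphism.

Lemma mderiv_shift_var i j :
  (shift_var i 0)^`M(lshift (n * k) j) = (('X - a%:P%:P) ^+ k)%:MP *+ (i == j).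
Proof.
pose dj : {additive T -> T} := @mderiv (n + n * k) S (lshift (n * k) j).
have djv m y : dj (('X - a%:P%:P)%:MP ^+ m * y) = ('X - a%:P%:P)%:MP ^+ m * dj y.
  by rewrite -mpolyC_exp /dj /= mderiv_mulC.
rewrite -[LHS]/(dj _) /shift_var (additive_taylor_shift _ _ _ djv) /taylor_shift /dj.
rewrite /= mderiv_gen big1 ?add0r => [|l _].
  by rewrite subn0 (inj_eq (@lshift_inj _ _)) eq_sym mulr_natr mpolyC_exp.
by rewrite /= mderiv_gen eq_lrshift mulr0.
Qed.

Lemma monic_det_equation :
  (\det (\matrix_(i < n, j < n) E i (lshift (n * k) j))) 0%N \is monic.
Proof.
rewrite -[_ 0%N]/(const_coef _) -det_map_mx.
rewrite (_ : map_mx _ _ = (('X - a%:P) ^+ k)%:M).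
  by rewrite det_scalar monic_exp // monic_exp // monicXsubC.
apply/matrixP => i j; rewrite !mxE /equation_var !mderivB mderivC subr0 mderiv_mulC.
rewrite mmapB rmorphM /= mmapC /= embed_tu_t mderiv_shift_var rmorphMn /= mmapC.
rewrite rmorphB rmorphM rmorphMn /= (_ : const_coef (fps_t K) = 0).
  rewrite mul0r subr0; congr (_ *+ _).
  rewrite rmorphXn /= embed_tu_v fps_u_const rmorphXn; congr (_ ^+ _).
  by rewrite [LHS]coefC.
by rewrite [LHS]coefX.
Qed.

Lemma linearized_equation_trivial (zeta : 'I_(n * k) -> {fps K}) (G : 'I_n -> A) :
  (forall i, \sum_p E i p * glue G (fun p => const_u (zeta p)) p = 0) ->
  forall p, zeta p = 0.
Proof.
move=> linE; pose y := glue G (fun p => const_u (zeta p)).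
pose D0 (q : T) := \sum_p ev q^`M(p) * y p.
have D0_add : zmod_morphism D0.
  move=> q q'; rewrite /D0 -sumrB; apply: eq_bigr => p _.
  by rewrite mderivB mmapB mulrBl.
have leibD0 : leibniz ev D0.
  move=> q q'; rewrite /D0 [X in X + _]mulr_sumr [X in _ + X]mulr_suml -big_split /=.
  apply: eq_bigr => p _; rewrite mderivM mmapD 2!(rmorphM ev) mulrDl addrC.
  by congr (_ + _); [rewrite mulrAC | rewrite mulrA].
pose D : {additive T -> A} := HB.pack D0 (GRing.isZmodMorphism.Build T A D0 D0_add).
have leibD : leibniz ev D := leibD0.
have DC c : D c%:MP = 0.
  by rewrite /D /= /D0 big1 // => p _; rewrite mderivC mmap0 mul0r.
have DX p : D 'X_p = y p.
  rewrite /D /= /D0 (bigD1 p) //= mderiv_gen eqxx rmorph1 mul1r big1 ?addr0 //.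
  by move=> q /negPf ne_q; rewrite mderiv_gen ne_q mmap0 mul0r.
pose Gam i := taylor_shift v (G i) (fun l => const_u (zeta (mxvec_index i l))).
have D_shift i j : D (shift_var i j) = Gam i j.
  rewrite (@additive_taylor_shift _ _ _ _ _ _ v) => [|m q]; last first.
    by rewrite leibD -mpolyC_exp DC mul0r addr0 /= mmapC /= rmorphXn /= embed_tu_v.
  rewrite DX /y glue_lshift; congr (_ + _); apply: eq_bigr => l _; congr (_ * _).
  by rewrite -[LHS]/(D 'X_ _) DX /y glue_rshift.
have GamE i : Gam i 0%N = fps_t K * D (rhs_var i).
  have : D (equation_var i) = 0 := linE i.
  rewrite /equation_var 2!(raddfB D) DC subr0 leibD DC mul0r addr0 D_shift.
  by rewrite mmapC /= embed_tu_t => /eqP; rewrite subr_eq0 => /eqP.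
have Gam0 m i : fps_agree m (Gam i 0%N) 0.
  elim: m i => [|m IHm] i //; apply/fps_agreeP; rewrite GamE.
  suff [q qE] : cong (fps_t K ^+ m) (D (rhs_var i)) 0.
    by exists q; rewrite subr0 -[D _]subr0 qE mulrA -exprS.
  rewrite (leibniz_mmap _ _ leibD) => [|c]; last exact: DC.
  apply: cong_lincomb0 => w.
  apply: (nth_catalytic_args_rel (P := fun q (_ : unit) =>
    cong (fps_t K ^+ m) (D q) 0) (Y' := fun _ _ => tt) (t' := tt) (u' := tt) (x0' := tt)).
  - by rewrite raddf0; apply: cong_refl.
  - move=> i' j le_jk; rewrite D_shift /Gam -iter_Delta_taylor_shift //.
    rewrite -[X in cong _ _ X](iter_Delta0 j).
    by apply/fps_agreeP; apply: iter_Delta_agree; apply: IHm.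
  - by rewrite DC; apply: cong_refl.
  by rewrite DC; apply: cong_refl.
have Gam0E i j : (j <= k)%N -> Gam i j = 0.
  move=> le_jk; rewrite /Gam -iter_Delta_taylor_shift // -[X in iter _ _ X]/(Gam i 0%N).
  rewrite -[RHS](iter_Delta0 j); congr (iter j _ _); apply/fpsP => m.
  exact: (Gam0 m.+1).
move=> p; case/mxvec_indexP: p => i l.
have := taylor_shift_rec v (G i) (fun l => const_u (zeta (mxvec_index i l))) l.
rewrite -/(Gam i) !Gam0E ?(ltnW (ltn_ord l)) // mulr0 addr0 => /esym/eqP.
rewrite raddf_eq0; last exact: fps_swap_inj.
by rewrite polyC_eq0 => /eqP.
Qed.

End PolynomialSystem.

Lemma algebraic_tu_embed (F : A) : algebraic_along (@embed_tu K) F -> algebraic_tu F.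
Proof.
move=> [P nzP PF0]; pose phi := tofrac \o @swapXY K.
exists (map_poly phi P).
  rewrite map_poly_eq0_id0 // /phi /= tofrac_eq0 swapXY_eq0 lead_coef_eq0 //.
rewrite -map_poly_comp (eq_map_poly (g := tofrac \o @embed_tu K)) => [|s].
  by rewrite rootE map_poly_horner_tofrac PF0 tofrac0.
by rewrite /phi /= embed_tuE /ratfun_embed frac_map_tofrac //; exact: fps_of_poly_inj.
Qed.

Lemma algebraic_tu_const (c : {fps K}) :
  algebraic_along (@fps_of_poly K) c -> algebraic_tu (const_u c).
Proof.
move=> [P nzP Pc0]; apply: algebraic_tu_embed; exists (map_poly polyC P).
  by rewrite map_poly_eq0_id0 // polyC_eq0 lead_coef_eq0.
rewrite -map_poly_comp (eq_map_poly (g := (@fps_swap K \o polyC) \o @fps_of_poly K)).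
  by rewrite map_poly_comp horner_map Pc0 /= polyC0 raddf0.
by move=> s; rewrite /= /embed_tu /= map_polyC.
Qed.

Lemma algebraic_taylor_shift k (h : A) (z : 'I_k -> {fps K}) j :
  algebraic_tu h -> (forall l, algebraic_tu (const_u (z l))) ->
  algebraic_tu (taylor_shift v h (fun l => const_u (z l)) j).
Proof.
move=> alg_h alg_z.
have algD (y y' : A) : algebraic_tu y -> algebraic_tu y' -> algebraic_tu (y + y').
  by move=> alg_y alg_y'; have := algebraic_add alg_y alg_y'; rewrite -tofracD.
have algM (y y' : A) : algebraic_tu y -> algebraic_tu y' -> algebraic_tu (y * y').
  by move=> alg_y alg_y'; have := algebraic_mul alg_y alg_y'; rewrite -tofracM.
have alg_emb (s : S) : algebraic_tu (embed_tu s).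
  rewrite /algebraic_tu (embed_tuE s) -frac_map_tofrac; first exact: algebraic_id.
  exact: fps_of_poly_inj.
have algX m : algebraic_tu (v ^+ m).
  by have := alg_emb (('X - a%:P%:P) ^+ m); rewrite rmorphXn /= embed_tu_v.
have alg0 : algebraic_tu (0 : A) by have := alg_emb 0; rewrite rmorph0.
refine (algD _ _ _ (algM _ _ (algX _) alg_h)).
refine (big_ind (@algebraic_tu K) alg0 algD _) => l _.
exact (algM _ _ (algX _) (alg_z l)).
Qed.

End Catalytic.

Theorem theorem1 (K : fieldType) (n k : nat) (a : K)
    (f : 'I_n -> {poly K}) (Q : 'I_n -> {mpoly K[n * k.+1 + 2]}) :
  [pchar K] =i pred0 -> (1 <= n)%N -> (1 <= k)%N ->
  exists F : 'I_n -> {fps {poly K}},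
    [/\ is_solution a f Q F,
        forall G : 'I_n -> {fps {poly K}}, is_solution a f Q G -> G =1 F
      & forall i : 'I_n, algebraic_tu (F i)].
Proof.
move=> charK _ _; have [F [solF uniqF]] := catalytic_fixpoint a f Q.
exists F; split=> // i.
have [H HP] := boolp.choice (fun j => taylor_decomposition a k (F j)).
have [z FE] := boolp.choice HP.
pose F' j := taylor_shift (fps_u K - fps_const a) (H j)
  (fun l => fps_swap (z j l)%:P) 0.
have {}solF : is_solution a f Q F'.
  by move: solF; rewrite (boolp.funext FE : F = F').
have sol_e j := ev_equation j solF.
have monJ := monic_det_equation a f Q H z.
rewrite FE; apply: algebraic_taylor_shift => [|l].
  apply: algebraic_tu_embed.
  exact: (algebraic_unknown charK sol_e monJ (@linearized_equation_trivial _ _ _ _ _ _ _ _)).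
apply: algebraic_tu_const.
have := algebraic_parameter charK sol_e monJ
  (@linearized_equation_trivial _ _ _ _ _ _ _ _) (mxvec_index i l).
by rewrite /taylor_index mxvecE mxE.
Qed.
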